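(* Let $0<\alpha<1$ and $m>1$. There exist a value $\beta>0$, a number $\eta^*=\eta^*(\beta)>0$ and a function $U\in M$ with $U>0$ on $[0,\eta^* )$ and $U=0$ on $[\eta^*,\infty)$, such that $$U(\eta)^{m+1}=1+(m+1)\left[-\beta\eta+\int_0^{\eta}\left(\left(1-\tfrac{\alpha}{2}\right)\eta-z\right)\,I[U](z)\,dz\right]\quad\text{for all } 0\le\eta\le\eta^*,$$ and such that the no-flux condition $$\lim_{\eta\to(\eta^* )^-}\,-U(\eta)^mU'(\eta)=0$$ is satisfied.
   Context: $C[0,\infty]$ denotes the continuous functions on the extended half-line $[0,\infty]$ (continuous real functions on $[0,\infty)$ having a finite limit at infinity). $M:=\{U\in C[0,\infty]: U(0)=1,\ 0\le U\le 1\}$. For a bounded continuous function $V$ on $[0,\infty)$, $I[V]=I^{0,1-\alpha}_{-2/\alpha}V$ is the Erdélyi–Kober operator $$I[V](\eta)=\frac{1}{\Gamma(1-\alpha)}\int_0^1(1-s)^{-\alpha}\,V\!\left(s^{-\alpha/2}\eta\right)ds .$$ Part of the no-flux condition is that $U$ is differentiable on $(0,\eta^* )$ near $\eta^*$, so that the limit makes sense. *)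

(* Defs.v *)
(* MathComp-Analysis.  A function on [0, +oo[ is represented by a total function
   R -> R of which only the values on [0, +oo[ are constrained or used. *)
From HB Require Import structures.
From mathcomp Require Import all_boot all_order all_algebra.
From mathcomp Require Import all_classical all_reals all_analysis.

Set Implicit Arguments.
Unset Strict Implicit.
Unset Printing Implicit Defensive.

Import Order.TTheory GRing.Theory Num.Theory.
Import numFieldNormedType.Exports.

Local Open Scope classical_set_scope.
Local Open Scope ring_scope.

(* Euler's integral; it converges for [0 < x], the only case of interest. *)
Definition Gamma (R : realType) (x : R) : R :=
  \int[@lebesgue_measure R]_(t in `]0, +oo[) (t `^ (x - 1) * expR (- t)).

(* The Erdelyi-Kober operator I^{0, 1 - alpha}_{- 2 / alpha}.  The integral is a
   Lebesgue integral, so the arbitrary values of the powers of 0 at the end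
   points s = 0 and s = 1 are irrelevant. *)
Definition erdelyi_kober (R : realType) (alpha : R) (V : R -> R) (eta : R) : R :=
  (Gamma (1 - alpha))^-1 *
  \int[@lebesgue_measure R]_(s in `[0, 1])
    ((1 - s) `^ (- alpha) * V (s `^ (- (alpha / 2)) * eta)).

(* The space C[0, +oo]; [cvg] in R means that the limit at infinity is finite. *)
Definition C0oo (R : realType) : set (R -> R) :=
  [set U : R -> R | {within `[0, +oo[, continuous U} /\
                    cvg (U x @[x --> +oo])].

Definition M_set (R : realType) : set (R -> R) :=
  [set U : R -> R | [/\ C0oo U, U 0 = 1 &
                    forall x : R, 0 <= x -> 0 <= U x <= 1]].

(* [derive1] is total, so differentiability near [e] on the left is explicit. *)
Definition no_flux (R : realType) (m : R) (U : R -> R) (e : R) : Prop :=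
  (\forall x \near e^'-, derivable U x 1) /\
  (- (U x `^ m * derive1 U x)) @[x --> e^'-] --> (0 : R).

(* Main.v *)
(** The no-flux condition at eta* determines beta, and the integral equation then
    takes the form
      U(x)^(m+1) = (m+1) \int_x^eta* (z - (1 - alpha/2) x) I[U](z) dz.
    As I[U](z) only involves the values of U on [z, +oo[, this is a Volterra
    equation started at eta* with value 0.  For eta* = 1 the (m+1)-th root of its
    right-hand side defines an order-preserving map of the nonincreasing functions
    with values in [0, C] into themselves (C large), and eps (1 - x)_+^2 (eps small)
    lies below its image; the supremum of all such subsolutions is therefore a fixed
    point (Knaster-Tarski) that is positive on [0, 1[.  It is continuous, hence so is I[U], and
      - U^m U' = (alpha/2) x I[U](x) + (1 - alpha/2) \int_x^1 I[U]
    tends to 0 at 1.  The equation is invariant under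
    U |-> c U(./l) with c^m = l^2, and c = 1 / U(0) gives U(0) = 1. *)
Require Import Defs.
From HB Require Import structures.
From mathcomp Require Import all_boot all_order all_algebra.
From mathcomp Require Import all_classical all_reals all_analysis.
From mathcomp Require Import measurable_realfun ring lra.

Set Implicit Arguments.
Unset Strict Implicit.
Unset Printing Implicit Defensive.

Import Order.TTheory GRing.Theory Num.Theory.
Import numFieldNormedType.Exports.

Local Open Scope classical_set_scope.
Local Open Scope ring_scope.

(** * Integrability of the singular weights *)

(** On closed subintervals the fundamental theorem of calculus bounds the integral by an increment
    of [F], and monotone convergence passes to []0, 1[]. Bounding the increments avoids any
    discussion of limits of [F] at the end points. *)
Lemma integrable_oo01_primitive (R : realType) (f F : R -> R) (M : R) :
  (forall x : R, 0 < x < 1 -> 0 <= f x) ->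
  (forall x : R, 0 < x < 1 -> {for x, continuous f}) ->
  (forall x : R, 0 < x < 1 -> is_derive x 1 F (f x)) ->
  (forall x y : R, 0 < x < 1 -> 0 < y < 1 -> F y - F x <= M) ->
  (@lebesgue_measure R).-integrable `]0, 1[ (EFin \o f).
Proof.
move=> f0 cf dF FM.
(* Starting at 1/3 keeps the left end strictly below the right one for every [n]. *)
pose E n : set R := `[n.+3%:R^-1, 1 - n.+3%:R^-1]%classic.
have e0 n : 0 < n.+3%:R^-1 :> R by rewrite invr_gt0 ltr0n.
have e3 n : n.+3%:R^-1 <= 3^-1 :> R by rewrite lef_pV2 ?posrE ?ltr0n// ler_nat.
have sub n x : E n x -> 0 < x < 1.
  by rewrite /E/= in_itv/=; move: (n.+3%:R^-1 : R) (e0 n) => e; lra.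
have mE n : measurable (E n) by exact: measurable_itv.
have mf : measurable_fun (`](0 : R), 1[%classic) f.
  apply: open_continuous_measurable_fun => //.
  by move=> x; rewrite inE/= in_itv/=; exact: cf.
have UE : \bigcup_n E n = `](0 : R), 1[%classic.
  apply/seteqP; split=> [x [n _ /sub]|x]; first by rewrite /= in_itv.
  rewrite /= in_itv/= => /andP[x0 x1].
  pose d := Num.min x (1 - x).
  have d0 : 0 < d by rewrite lt_min x0 subr_gt0.
  have := @near_infty_natSinv_lt R (PosNum d0).
  case=> N _ /(_ N.+2) /= /(_ (ltnW (ltnW (leqnn _)))) hN.
  exists N => //; rewrite /E/= in_itv/=.
  by move: hN; rewrite lt_min => /andP[]; move: (N.+3%:R^-1 : R) => e; lra.
apply/integrableP; split; first exact/measurable_EFinP.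
have -> : (\int[@lebesgue_measure R]_(x in `]0%R, 1%R[) `|(EFin \o f) x| =
          \int[@lebesgue_measure R]_(x in `]0%R, 1%R[) (f x)%:E)%E.
  apply: eq_integral => x; rewrite inE/= in_itv/= => x01.
  by rewrite ger0_norm ?f0.
have cv : (\int[@lebesgue_measure R]_(x in E i) (f x)%:E)%E @[i --> \oo] -->
          (\int[@lebesgue_measure R]_(x in `]0%R, 1%R[) (f x)%:E)%E.
  rewrite -UE; apply: ge0_nondecreasing_set_cvg_integral => //.
  - apply/nondecreasing_seqP => n; rewrite subsetEset => x.
    rewrite /E/= !in_itv/=.
    have : n.+4%:R^-1 <= n.+3%:R^-1 :> R by rewrite lef_pV2 ?posrE ?ltr0n// ler_nat.
    by move: (n.+4%:R^-1 : R) (n.+3%:R^-1 : R) => e e'; lra.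
  - move=> n; apply/measurable_EFinP; apply: measurable_funS mf => // x /sub.
    by rewrite /= in_itv.
  - by move=> n x /sub x01; rewrite lee_fin f0.
suff : (\int[@lebesgue_measure R]_(x in `]0%R, 1%R[) (f x)%:E <= M%:E)%E.
  by move=> h; apply: le_lt_trans h _; rewrite ltry.
rewrite -(cvg_lim _ cv)//; apply: lime_le; first by apply/cvg_ex; eexists; exact: cv.
apply: nearW => n.
have ab : n.+3%:R^-1 < 1 - n.+3%:R^-1 :> R by move: (n.+3%:R^-1 : R) (e0 n) (e3 n) => e; lra.
have cF x : 0 < x < 1 -> {for x, continuous F}.
  by move=> /dF[+ _] => /derivable1_diffP/differentiable_continuous.
have a01 : 0 < (n.+3%:R^-1 : R) < 1 by move: (n.+3%:R^-1 : R) (e0 n) (e3 n) => e; lra.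
have b01 : 0 < 1 - (n.+3%:R^-1 : R) < 1 by move: (n.+3%:R^-1 : R) (e0 n) (e3 n) => e; lra.
rewrite (@continuous_FTC2 _ f F)//.
- by rewrite -EFinB lee_fin FM.
- by apply: continuous_in_subspaceT => x; rewrite inE => /sub; exact: cf.
- split.
  + move=> x; rewrite in_itv/= => xab.
    by apply: ex_derive; apply: dF; move: (n.+3%:R^-1 : R) (e0 n) xab => e; lra.
  + by apply: cvg_at_right_filter; exact: cF.
  + by apply: cvg_at_left_filter; exact: cF.
- move=> x; rewrite in_itv/= => xab; rewrite derive1E; apply: derive_val.
  by apply: dF; move: (n.+3%:R^-1 : R) (e0 n) xab => e; lra.
Qed.

Lemma powR_le1 (R : realType) (x p : R) : 0 <= x -> x <= 1 -> 0 <= p -> x `^ p <= 1.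
Proof.
move=> x0 x1 p0; have := @ge0_ler_powR _ _ p0 x 1.
by rewrite powR1 !nnegrE; apply.
Qed.

Lemma ge0_subset_Rintegral (R : realType) (A B : set R) (f : R -> R) :
  measurable A -> measurable B ->
  (@lebesgue_measure R).-integrable B (EFin \o f) ->
  (forall x, B x -> 0 <= f x) -> A `<=` B ->
  \int[@lebesgue_measure R]_(x in A) f x <= \int[@lebesgue_measure R]_(x in B) f x.
Proof.
move=> mA mB fB f0 AB; apply: fine_le.
- by apply: integrable_fin_num => //; exact: integrableS fB.
- exact: integrable_fin_num.
- by apply: ge0_subset_integral => //; case/integrableP : fB.
Qed.

Lemma integrable_powRN (R : realType) (a : R) : 0 < a < 1 ->
  (@lebesgue_measure R).-integrable `]0, 1[ (EFin \o (fun t : R => t `^ (- a))).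
Proof.
move=> a01; have b0 : 0 < 1 - a by lra.
apply: (@integrable_oo01_primitive _ _ (fun t => (1 - a)^-1 * t `^ (1 - a)) (1 - a)^-1).
- by move=> x _; exact: powR_ge0.
- move=> x /andP[x0 _]; apply: differentiable_continuous.
  by apply/derivable1_diffP; apply: ex_derive; exact: is_derive1_powR.
- move=> x /andP[x0 _].
  apply: is_derive_eq; first by apply: is_deriveZ; exact: is_derive1_powR.
  rewrite /GRing.scale/= mulrA mulVf ?gt_eqF// mul1r; congr (_ `^ _); ring.
- move=> x y /andP[x0 _] /andP[y0 y1].
  rewrite -mulrBr ger_pMr ?invr_gt0//.
  have : y `^ (1 - a) <= 1.
    by rewrite powR_le1 ?ltW.
  by have := powR_ge0 x (1 - a); lra.
Qed.

Lemma integrable_powRN_onem (R : realType) (a : R) : 0 < a < 1 ->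
  (@lebesgue_measure R).-integrable `]0, 1[ (EFin \o (fun s : R => (1 - s) `^ (- a))).
Proof.
move=> a01; have b0 : 0 < 1 - a by lra.
have dB (x : R) : is_derive x 1 (fun s : R => 1 - s) (- 1).
  by rewrite -[- 1]sub0r; exact: is_deriveB.
apply: (@integrable_oo01_primitive _ _
  (fun s => - (1 - a)^-1 * (1 - s) `^ (1 - a)) (1 - a)^-1).
- by move=> x _; exact: powR_ge0.
- move=> x /andP[_ x1]; apply: differentiable_continuous.
  apply/derivable1_diffP; apply: ex_derive.
  apply: (@is_derive1_comp _ (fun t => t `^ (- a)) (fun s => 1 - s)).
  by apply: is_derive1_powR; rewrite subr_gt0.
- move=> x /andP[_ x1].
  apply: is_derive_eq.
    apply: is_deriveZ.
    apply: (@is_derive1_comp _ (fun t => t `^ (1 - a)) (fun s => 1 - s)).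
    by apply: is_derive1_powR; rewrite subr_gt0.
  rewrite /GRing.scale/= mulrN1 mulrNN mulrA mulVf ?gt_eqF// mul1r; congr (_ `^ _); ring.
- move=> x y /andP[x0 x1] /andP[y0 y1].
  rewrite !mulNr opprK addrC -mulrBr ger_pMr ?invr_gt0//.
  have : (1 - x) `^ (1 - a) <= 1.
    by apply: powR_le1; lra.
  by have := powR_ge0 (1 - y) (1 - a); lra.
Qed.

Lemma lebesgue_measure_itv_bnd (R : realType) (b0 b1 : bool) (x y : R) : x <= y ->
  @lebesgue_measure R [set` Interval (BSide b0 x) (BSide b1 y)] = (y - x)%:E.
Proof.
move=> xy; transitivity (if (x < y)%R then (y - x)%:E else 0%E); last first.
  case: ltP => // yx; congr (_%:E); apply/esym/eqP.
  by rewrite subr_eq0 eq_le xy yx.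
exact: lebesgue_measure_itv.
Qed.

Lemma Rintegral_cst_itv (R : realType) (b0 b1 : bool) (x y k : R) : x <= y ->
  \int[@lebesgue_measure R]_(t in [set` Interval (BSide b0 x) (BSide b1 y)])
    (cst k t) = k * (y - x).
Proof.
move=> xy; transitivity (k * fine
    (@lebesgue_measure R [set` Interval (BSide b0 x) (BSide b1 y)])).
  exact: Rintegral_cst.
by rewrite lebesgue_measure_itv_bnd.
Qed.

Lemma integrable_bounded_itv (R : realType) (b0 b1 : bool) (x y : R) (f : R -> R) (k : R) :
  measurable_fun [set: R] f -> (forall t, x <= t <= y -> `|f t| <= k) ->
  (@lebesgue_measure R).-integrable [set` Interval (BSide b0 x) (BSide b1 y)] (EFin \o f).
Proof.
move=> mf fk; apply: measurable_bounded_integrable => //.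
- have [xy|yx] := leP x y.
    apply: (@le_lt_trans _ _ (y - x)%:E); last exact: ltry.
    by rewrite -(lebesgue_measure_itv_bnd b0 b1 xy).
  rewrite set_itv_ge ?measure0//.
  by case: b0; case: b1; rewrite bnd_simp -?leNgt -?ltNge ?ltW.
- exact: measurable_funTS.
- exists k; split; first exact: num_real.
  move=> M kM t tI; apply/ltW/(le_lt_trans _ kM)/fk.
  by move: tI; case: b0; case: b1; rewrite /= in_itv/= => /andP[h1 h2];
    apply/andP; split=> //; exact: ltW.
Qed.

Lemma integrable_cst_itv (R : realType) (b0 b1 : bool) (x y k : R) :
  (@lebesgue_measure R).-integrable [set` Interval (BSide b0 x) (BSide b1 y)]
    (EFin \o cst k).
Proof. by apply: (@integrable_bounded_itv _ _ _ _ _ _ `|k|). Qed.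

(** Convergence comes first, since a real-valued integral that diverges to +oo has the default value
    0. Positivity then follows from the lower bound exp(-1) of the integrand on []0, 1[]. *)
Lemma Gamma_gt0 (R : realType) (x : R) : 0 < x < 1 -> 0 < Gamma x.
Proof.
move=> x01; rewrite /Gamma.
have xE : x - 1 = - (1 - x) by rewrite opprB.
pose h (t : R) := t `^ (x - 1) * expR (- t).
have h0 t : 0 <= h t by rewrite mulr_ge0// ?powR_ge0// expR_ge0.
have mh : measurable_fun [set: R] h.
  apply: measurable_funM; first exact: measurable_powR.
  by apply: measurableT_comp => //; apply: measurableT_comp.
have ih : (@lebesgue_measure R).-integrable `]0, +oo[ (EFin \o h).
  (* The majorant is [p] plus the exponential density: [p] controls the singularity for t < 1, the
     density controls the tail. *)
  pose p : R -> R := (fun t : R => t `^ (- (1 - x))) \_ `]0, 1[.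
  have ip : (@lebesgue_measure R).-integrable setT (EFin \o p).
    rewrite /p -restrict_EFin; apply: (integrable_mkcond _ _).1 => //.
    by apply: integrable_powRN; lra.
  have : (@lebesgue_measure R).-integrable `]0%R, +oo[
      (EFin \o p \+ (EFin \o exponential_pdf 1))%E.
    apply: (integrableS measurableT) => //; apply: integrableD => //.
    exact: integrable_exponential_pdf.
  apply: le_integrable => //.
    by apply/measurable_EFinP; exact: measurable_funTS.
  move=> t; rewrite /= in_itv/= andbT => t0.
  rewrite lee_fin ger0_norm// (le_trans _ (ler_norm _))//.
  rewrite (exponential_pdfE _ (ltW t0)) /h mul1r mulN1r.
  have p0 s : 0 <= p s.
    by rewrite /p patchE; case: ifP => // _; exact: powR_ge0.
  have [t1|t1] := ltP t 1.
    rewrite (_ : p t = t `^ (x - 1)); last first.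
      by rewrite /p patchE mem_set/= ?in_itv/= ?t0// opprB.
    have : t `^ (x - 1) * expR (- t) <= t `^ (x - 1).
      by rewrite ler_piMr ?powR_ge0// -expR0 ler_expR lerNl oppr0 ltW.
    by move=> /le_trans; apply; rewrite lerDl expR_ge0.
  have : t `^ (x - 1) * expR (- t) <= expR (- t).
    rewrite ler_piMl ?expR_ge0// xE powRN.
    rewrite invf_le1 ?powR_gt0//.
    by rewrite -[leLHS](powRr0 t) ler_powR//; lra.
  by move/le_trans; apply; rewrite lerDr.
apply: (@lt_le_trans _ _ (expR (- 1))); first exact: expR_gt0.
apply: (@le_trans _ _ (\int[@lebesgue_measure R]_(t in `]0, 1[) h t)); last first.
  apply: ge0_subset_Rintegral => //.
  by apply: subset_itvl; rewrite bnd_simp.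
have -> : expR (- 1) = \int[@lebesgue_measure R]_(t in `]0, 1[) (cst (expR (-1)) t) :> R.
  by rewrite Rintegral_cst_itv ?ler01// subr0 mulr1.
apply: le_Rintegral => //.
- exact: integrable_cst_itv.
- apply: integrableS ih => //; apply: subset_itvl; rewrite bnd_simp//.
- move=> t; rewrite /= in_itv/= => /andP[t0 t1].
  rewrite /h -[leLHS]mul1r ler_pM// ?expR_ge0//.
    rewrite xE powRN.
    rewrite invf_ge1 ?powR_gt0//; apply: powR_le1; lra.
  by rewrite ler_expR lerN2 ltW.
Qed.

(** * The Erdelyi-Kober operator on monotone functions *)

Section ErdelyiKoberMonotone.
Context {R : realType}.
Notation mu := (@lebesgue_measure R).
Implicit Types (a C x y z : R) (V W : R -> R).

(* Monotonicity on the whole line makes every function occurring in the fixed-point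
   argument measurable. *)
Definition profile C V : Prop := nonincreasing_fun V /\ forall x, 0 <= V x <= C.

Definition ek_weight a (s : R) : R := (1 - s) `^ (- a).

(** This is the value of the operator at the constant function 1, that is 1 / Gamma(2 - a) for 0 < a
    < 1. *)
Definition ek_norm a : R := (Gamma (1 - a))^-1 * \int[mu]_(s in `]0, 1[) ek_weight a s.

Lemma profile_measurable C V : profile C V -> measurable_fun [set: R] V.
Proof. by move=> [nV _]; exact: nonincreasing_measurable. Qed.

Lemma measurable_ek_weight a : measurable_fun [set: R] (ek_weight a).
Proof.
rewrite (_ : ek_weight a = (@powR R ^~ (- a)) \o (fun s => 1 - s))//.
apply: measurableT_comp; first exact: measurable_powR.
exact: measurable_funB.
Qed.

Lemma measurable_ek_integrand a C V x : profile C V ->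
  measurable_fun [set: R] (fun s => ek_weight a s * V (s `^ (- (a / 2)) * x)).
Proof.
move=> pV; apply: measurable_funM; first exact: measurable_ek_weight.
apply: measurableT_comp; first exact: profile_measurable pV.
by apply: measurable_funM => //; exact: measurable_powR.
Qed.

(** Dropping the end points discards s = 0, where a power with nonzero exponent has the default
    value 0 and so violates s^(-a/2) >= 1. *)
Lemma erdelyi_koberE a C V x : profile C V ->
  erdelyi_kober a V x = (Gamma (1 - a))^-1 *
    \int[mu]_(s in `]0, 1[) (ek_weight a s * V (s `^ (- (a / 2)) * x)).
Proof.
move=> pV; rewrite /erdelyi_kober /Rintegral; congr (_ * fine _).
apply: integral_itv_bndoo; apply/measurable_EFinP; apply: measurable_funTS.
exact: measurable_ek_integrand pV.
Qed.

Lemma ek_weight_ge0 a s : 0 <= ek_weight a s.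
Proof. exact: powR_ge0. Qed.

Lemma integrable_ek_weightZr a C : 0 < a < 1 ->
  mu.-integrable `]0, 1[ (EFin \o (fun s => ek_weight a s * C)).
Proof.
move=> a01; rewrite (_ : _ \o _ = (fun s => C%:E * (EFin \o ek_weight a) s)%E).
  by apply: integrableZl => //; exact: integrable_powRN_onem.
by apply/funext => s; rewrite /= mulrC.
Qed.

Lemma integrable_ek_integrand a C V x : 0 < a < 1 -> profile C V ->
  mu.-integrable `]0, 1[
    (EFin \o (fun s => ek_weight a s * V (s `^ (- (a / 2)) * x))).
Proof.
move=> a01 pV.
apply: (le_integrable _ _ _ (integrable_ek_weightZr C a01)) => //.
  by apply/measurable_EFinP; apply: measurable_funTS; exact: measurable_ek_integrand pV.
move=> s _; rewrite /= lee_fin.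
have /andP[V0 VC] := pV.2 (s `^ (- (a / 2)) * x).
rewrite !ger0_norm ?mulr_ge0 ?ek_weight_ge0// ?(le_trans V0)//.
by rewrite ler_wpM2l ?ek_weight_ge0.
Qed.

Lemma Gamma_onem_gt0 a : 0 < a < 1 -> 0 < (Gamma (1 - a))^-1.
Proof. by move=> a01; rewrite invr_gt0 Gamma_gt0//; lra. Qed.

(** With [x = y] this yields monotonicity in the function, with [V = W] monotonicity in the
    point. *)
Lemma le_erdelyi_kober a C D V W x y : 0 < a < 1 -> profile C V -> profile D W ->
  (forall s, 0 < s < 1 -> V (s `^ (- (a / 2)) * x) <= W (s `^ (- (a / 2)) * y)) ->
  erdelyi_kober a V x <= erdelyi_kober a W y.
Proof.
move=> a01 pV pW VW; rewrite (erdelyi_koberE _ _ pV) (erdelyi_koberE _ _ pW).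
rewrite ler_wpM2l ?(ltW (Gamma_onem_gt0 a01))//.
apply: le_Rintegral => //; first exact: integrable_ek_integrand pV.
  exact: integrable_ek_integrand pW.
move=> s; rewrite /= in_itv/= => s01.
by rewrite ler_wpM2l ?ek_weight_ge0// VW.
Qed.

(** As s^(-a/2) >= 1, only values of [V] to the right of [x] are sampled, and these are at most
    [V x]. It follows that the operator preserves vanishing beyond the front. *)
Lemma erdelyi_kober_le_value a C V x : 0 < a < 1 -> profile C V -> 0 <= x ->
  erdelyi_kober a V x <= ek_norm a * V x.
Proof.
move=> a01 pV x0; have [nV Vb] := pV.
rewrite (erdelyi_koberE _ _ pV) /ek_norm -mulrA.
rewrite ler_wpM2l ?(ltW (Gamma_onem_gt0 a01))//.
rewrite -RintegralZr//; last exact: integrable_powRN_onem.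
apply: le_Rintegral => //; first exact: integrable_ek_integrand pV.
  exact: integrable_ek_weightZr.
move=> s; rewrite /= in_itv/= => /andP[s0 s1].
rewrite ler_wpM2l ?ek_weight_ge0//; apply: nV.
rewrite ler_peMl// powRN invf_ge1 ?powR_gt0//.
by case/andP: a01 => a0 _; rewrite powR_le1 ?divr_ge0// ltW.
Qed.

Lemma erdelyi_kober_profile a C V : 0 < a < 1 -> profile C V ->
  profile (ek_norm a * C) (erdelyi_kober a V).
Proof.
move=> a01 pV; have [nV Vb] := pV; split => [x y xy|x].
  apply: (@le_erdelyi_kober _ C C) => // s _; apply: nV.
  by rewrite ler_wpM2l ?powR_ge0.
rewrite (erdelyi_koberE _ _ pV); apply/andP; split.
  rewrite mulr_ge0 ?(ltW (Gamma_onem_gt0 a01))//.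
  apply: Rintegral_ge0 => s _; rewrite mulr_ge0 ?ek_weight_ge0//.
  by have /andP[] := Vb (s `^ (- (a / 2)) * x).
rewrite /ek_norm -mulrA.
rewrite ler_wpM2l ?(ltW (Gamma_onem_gt0 a01))//.
rewrite -RintegralZr//; last exact: integrable_powRN_onem.
apply: le_Rintegral => //; first exact: integrable_ek_integrand pV.
  exact: integrable_ek_weightZr.
move=> s _; rewrite ler_wpM2l ?ek_weight_ge0//.
by have /andP[] := Vb (s `^ (- (a / 2)) * x).
Qed.

End ErdelyiKoberMonotone.

(** * The Volterra map and its fixed points *)

Section VolterraOperator.
Context {R : realType}.
Notation mu := (@lebesgue_measure R).
Implicit Types (a m x y z B C : R) (g h V W : R -> R).

Definition volterra a g x : R :=
  \int[mu]_(z in `]x, 1]) ((z - (1 - a / 2) * x) * g z).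

(* Extended to [x < 0] by its value at 0, so that it is nonincreasing on R. *)
Definition porous_map a m V x : R :=
  ((m + 1) * volterra a (erdelyi_kober a V) (Num.max 0 x)) `^ (m + 1)^-1.

(** The kernel is at least a x / 2. This sign makes the equation started at the front
    order-preserving, whereas the kernel integrated from 0 changes sign. *)
Lemma kernel_ge0 a x z : 0 < a < 1 -> 0 <= x -> x <= z -> 0 <= z - (1 - a / 2) * x.
Proof. move=> a01 x0 xz; nra. Qed.

Lemma measurable_volterra_integrand a B g x : profile B g ->
  measurable_fun [set: R] (fun z => (z - (1 - a / 2) * x) * g z).
Proof.
move=> pg; apply: measurable_funM; last exact: profile_measurable pg.
exact: measurable_funB.
Qed.

Lemma volterra_integrand_bound a B g x z : 0 < a < 1 -> profile B g ->
  0 <= x -> x <= z -> z <= 1 -> 0 <= (z - (1 - a / 2) * x) * g z <= B.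
Proof.
move=> a01 [_ /(_ z)/andP[g0 gB]] x0 xz z1; have k0 := kernel_ge0 a01 x0 xz.
rewrite mulr_ge0//= (le_trans _ gB)// ler_piMl//; nra.
Qed.

Lemma integrable_volterra a B g x (b0 b1 : bool) y z : 0 < a < 1 -> profile B g ->
  0 <= x -> x <= y -> z <= 1 ->
  mu.-integrable [set` Interval (BSide b0 y) (BSide b1 z)]
    (EFin \o (fun z => (z - (1 - a / 2) * x) * g z)).
Proof.
move=> a01 pg x0 xy z1; apply: (@integrable_bounded_itv _ _ _ _ _ _ B).
  exact: measurable_volterra_integrand pg.
move=> t /andP[yt tz].
have /andP[h0 hB] := volterra_integrand_bound a01 pg x0 (le_trans xy yt) (le_trans tz z1).
by rewrite ger0_norm.
Qed.

Lemma volterra_ge0 a B g x : 0 < a < 1 -> profile B g -> 0 <= x -> 0 <= volterra a g x.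
Proof.
move=> a01 pg x0; apply: Rintegral_ge0 => z; rewrite /= in_itv/= => /andP[xz z1].
by have /andP[] := volterra_integrand_bound a01 pg x0 (ltW xz) z1.
Qed.

Lemma volterra_ge1 a g x : 1 <= x -> volterra a g x = 0.
Proof. by move=> x1; rewrite /volterra set_itv_ge ?Rintegral_set0// bnd_simp -leNgt. Qed.

Lemma le_volterra a B C g h x : 0 < a < 1 -> profile B g -> profile C h -> 0 <= x ->
  (forall z, x <= z -> g z <= h z) -> volterra a g x <= volterra a h x.
Proof.
move=> a01 pg ph x0 gh; apply: le_Rintegral => //.
- exact: integrable_volterra pg _ _ _.
- exact: integrable_volterra ph _ _ _.
- move=> z; rewrite /= in_itv/= => /andP[/ltW xz z1].
  by rewrite ler_wpM2l ?gh// kernel_ge0.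
Qed.

(** Moving from [x] to [y] lowers the kernel and shrinks the domain; the intermediate integral has
    the kernel of [x] on the domain of [y]. *)
Lemma volterra_nonincreasing a B g x y : 0 < a < 1 -> profile B g -> 0 <= x -> x <= y ->
  volterra a g y <= volterra a g x.
Proof.
move=> a01 pg x0 xy; have [_ gb] := pg.
apply: (@le_trans _ _ (\int[mu]_(z in `]y, 1]) ((z - (1 - a / 2) * x) * g z))).
  apply: le_Rintegral => //.
  - by apply: integrable_volterra pg _ _ _ => //; exact: le_trans xy.
  - exact: integrable_volterra pg _ _ _.
  - move=> z _; have /andP[g0 _] := gb z; rewrite ler_wpM2r//; nra.
apply: ge0_subset_Rintegral => //.
- exact: integrable_volterra pg _ _ _.
- move=> z; rewrite /= in_itv/= => /andP[/ltW xz z1].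
  by have /andP[] := volterra_integrand_bound a01 pg x0 xz z1.
- by apply: subset_itvr; rewrite bnd_simp.
Qed.

Lemma volterra_le a B g x : 0 < a < 1 -> profile B g -> 0 <= x -> volterra a g x <= B.
Proof.
move=> a01 pg x0; have B0 : 0 <= B.
  by have /andP[] := pg.2 0; exact: le_trans.
have [x1|x1] := leP x 1; last by rewrite volterra_ge1// ltW.
apply: (@le_trans _ _ (\int[mu]_(z in `]x, 1]) (cst B z))).
  apply: le_Rintegral => //.
  - exact: integrable_volterra pg _ _ _.
  - exact: integrable_cst_itv.
  - move=> z; rewrite /= in_itv/= => /andP[/ltW xz z1].
    by have /andP[] := volterra_integrand_bound a01 pg x0 xz z1.
rewrite Rintegral_cst_itv//; nra.
Qed.

(** The inequality on [C] makes the constant [C] an upper barrier, because [volterra] is at most the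
    bound [ek_norm a * C] of its density. *)
Lemma porous_map_profile a m C V : 0 < a < 1 -> 1 < m -> profile C V ->
  (m + 1) * (ek_norm a * C) <= C `^ (m + 1) -> profile C (porous_map a m V).
Proof.
move=> a01 m1 pV hC; have pg := erdelyi_kober_profile a01 pV.
have m0 : 0 <= m + 1 by lra.
have mV0 : 0 <= (m + 1)^-1 by rewrite invr_ge0.
have M0 x : 0 <= Num.max 0 x by rewrite le_max lexx.
have C0 : 0 <= C by have /andP[] := pV.2 0; exact: le_trans.
have v0 x : 0 <= (m + 1) * volterra a (erdelyi_kober a V) (Num.max 0 x).
  by rewrite mulr_ge0//; exact: volterra_ge0 pg _.
split => [x y xy|x].
  apply: ge0_ler_powR; rewrite ?nnegrE//.
  rewrite ler_wpM2l//; apply: volterra_nonincreasing pg _ _ => //.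
  by rewrite ge_max le_max lexx/= le_max xy orbT.
rewrite powR_ge0/=.
have -> : C = (C `^ (m + 1)) `^ (m + 1)^-1.
  by rewrite -powRrM mulfV ?powRr1//; apply/eqP; lra.
apply: ge0_ler_powR; rewrite ?nnegrE ?powR_ge0//.
by apply: le_trans hC; rewrite ler_wpM2l//; exact: volterra_le pg _.
Qed.

Lemma le_porous_map a m C D V W x : 0 < a < 1 -> 1 < m -> profile C V -> profile D W ->
  (forall y, V y <= W y) -> porous_map a m V x <= porous_map a m W x.
Proof.
move=> a01 m1 pV pW VW.
have pg := erdelyi_kober_profile a01 pV; have ph := erdelyi_kober_profile a01 pW.
have M0 : 0 <= Num.max 0 x by rewrite le_max lexx.
have mp : 0 <= m + 1 by lra.
apply: ge0_ler_powR.
- by rewrite invr_ge0.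
- by rewrite nnegrE; apply: mulr_ge0 => //; exact: volterra_ge0 pg _.
- by rewrite nnegrE; apply: mulr_ge0 => //; exact: volterra_ge0 ph _.
- apply: ler_wpM2l => //; apply: (le_volterra a01 pg ph M0) => z _.
  by apply: (le_erdelyi_kober a01 pV pW) => s _; exact: VW.
Qed.

(** A pointwise supremum of nonincreasing functions is nonincreasing, so even an uncountable family
    of subsolutions has a measurable supremum in the same class. *)
Lemma porous_map_fixpoint a m C V : 0 < a < 1 -> 1 < m -> profile C V ->
  (m + 1) * (ek_norm a * C) <= C `^ (m + 1) ->
  (forall x, V x <= porous_map a m V x) ->
  exists U, [/\ profile C U, forall x, V x <= U x & forall x, U x = porous_map a m U x].
Proof.
move=> a01 m1 pV hC subV.
pose S W := profile C W /\ forall x, W x <= porous_map a m W x.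
pose E x := [set W x | W in S].
pose U x := sup (E x).
have ubE x : has_ubound (E x).
  by exists C => _ [W [[_ /(_ x)/andP[_ WC]] _] <-].
have SU W : S W -> forall x, W x <= U x.
  by move=> SW x; apply: ub_le_sup => //; exists W.
have E0 x : E x !=set0 by exists (V x), V.
have pU : profile C U.
  split=> [x y xy|x].
    apply: ge_sup => // _ [W SW <-]; apply: le_trans (SU _ SW x).
    by case: SW => -[nW _] _; exact: nW.
  apply/andP; split; last by apply: ge_sup => // _ [W [[_ /(_ x)/andP[_ WC]] _] <-].
  have SV : S V by [].
  by apply: le_trans (SU _ SV x); case/andP: (pV.2 x).
have UT x : U x <= porous_map a m U x.
  apply: ge_sup => // _ [W SW <-]; have [pW WT] := SW.
  by apply: (le_trans (WT x)); apply: (le_porous_map _ a01 m1 pW pU); exact: SU.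
exists U; split=> //; first by apply: SU.
(* By monotonicity the image of [U] is again a subsolution, hence lies below the supremum [U]. *)
have pT := porous_map_profile a01 m1 pU hC.
move=> x; apply/eqP; rewrite eq_le UT/=; apply: SU.
split=> [|y]; first exact: pT.
exact: (le_porous_map y a01 m1 pU pT UT).
Qed.

End VolterraOperator.

(** * An explicit positive subsolution *)

Section Subsolution.
Context {R : realType}.
Notation mu := (@lebesgue_measure R).
Implicit Types (a m x y z C e : R).

(* Why the exponent 2: [bump e x `^ (m + 1)] vanishes at 1 to the order
   [2 (m + 1) >= 4], and 4 is the order in [volterra_bump]. *)
Definition bump e x : R := e * (Num.max 0 (1 - Num.max 0 x)) ^+ 2.

Lemma bumpE e x : 0 <= x -> x <= 1 -> bump e x = e * (1 - x) ^+ 2.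
Proof.
move=> x0 x1; rewrite /bump (max_idPr x0) (@max_idPr _ _ 0 (1 - x) _)//.
by rewrite subr_ge0.
Qed.

Lemma bump_profile e : 0 <= e -> profile e (bump e).
Proof.
move=> e0; split=> [x y xy|x]; rewrite /bump.
  have M0 (t : R) : 0 <= Num.max 0 t by rewrite le_max lexx.
  apply: ler_wpM2l => //; apply: lerXn2r; rewrite ?nnegrE ?M0//.
  rewrite ge_max M0/= le_max; apply/orP; right.
  by rewrite lerB// ge_max M0/= le_max xy orbT.
rewrite mulr_ge0 ?sqr_ge0//= ler_piMr// expr_le1//; last by rewrite le_max lexx.
by rewrite ge_max ler01/= lerBlDr lerDl le_max lexx.
Qed.

(** Only s in []q, 1[] is kept, with q = (1 + z) / 2, an interval of length (1 - z) / 2. There the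
    weight is at least 1 and s^(-a/2) z <= z / s <= q, as z <= q^2; so the bump is at least e ((1 -
    z) / 2)^2. *)
Lemma erdelyi_kober_bump a e z : 0 < a < 1 -> 0 <= e -> 0 <= z -> z < 1 ->
  (Gamma (1 - a))^-1 * (e * ((1 - z) / 2) ^+ 3) <= erdelyi_kober a (bump e) z.
Proof.
move=> a01 e0 z0 z1; have pb := bump_profile e0.
rewrite (erdelyi_koberE _ _ pb).
apply: ler_wpM2l; first exact: ltW (Gamma_onem_gt0 a01).
pose q := (1 + z) / 2.
have q1 : q <= 1 by rewrite /q; lra.
have q0 : 0 < q by rewrite /q; lra.
have b0 s : 0 <= bump e s by have /andP[] := pb.2 s.
apply: (@le_trans _ _ (\int[mu]_(s in `]q, 1[)
    (ek_weight a s * bump e (s `^ (- (a / 2)) * z)))); last first.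
  apply: ge0_subset_Rintegral => //.
  - exact: integrable_ek_integrand pb.
  - by move=> s _; rewrite mulr_ge0// ek_weight_ge0.
  - by apply: subset_itvr; rewrite bnd_simp ltW.
apply: (@le_trans _ _ (\int[mu]_(s in `]q, 1[) cst (e * ((1 - z) / 2) ^+ 2) s)).
  rewrite Rintegral_cst_itv// le_eqVlt; apply/orP; left; apply/eqP.
  by rewrite /q; field.
apply: le_Rintegral => //.
- exact: integrable_cst_itv.
- apply: integrableS (integrable_ek_integrand z a01 pb) => //.
  by apply: subset_itvr; rewrite bnd_simp ltW.
- move=> s; rewrite /= in_itv/= => /andP[qs s1].
  have s0 : 0 < s by exact: lt_trans qs.
  have w1 : 1 <= ek_weight a s.
    rewrite /ek_weight powRN invf_ge1 ?powR_gt0 ?subr_gt0// powR_le1//; lra.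
  have hz : s `^ (- (a / 2)) * z <= q.
    apply: (@le_trans _ _ (s^-1 * z)).
      apply: ler_wpM2r => //; rewrite -(powR_inv1 (ltW s0)).
      have s01 : 0 < s <= 1 by rewrite s0 ltW.
      by apply: (ger_powR s01); lra.
    by rewrite mulrC ler_pdivrMr// /q; rewrite /q in qs; nra.
  apply: (@le_trans _ _ (bump e q)).
    rewrite bumpE ?(ltW q0)// /q le_eqVlt; apply/orP; left; apply/eqP.
    by congr (_ * _ ^+ 2); field.
  apply: (@le_trans _ _ (bump e (s `^ (- (a / 2)) * z))); first exact: pb.1.
  by rewrite ler_peMl.
Qed.

(** Only z in []p, q]] is kept, of length (1 - x) / 4 and at distance (1 - x) / 4 from 1, where the
    previous bound degenerates. The kernel is at least a / 4 there, and 8192 = 4 * 8^3 * 4. *)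
Lemma volterra_bump a e x : 0 < a < 1 -> 0 <= e -> 0 <= x -> x < 1 ->
  a * (Gamma (1 - a))^-1 / 8192 * e * (1 - x) ^+ 4
    <= volterra a (erdelyi_kober a (bump e)) x.
Proof.
move=> a01 e0 x0 x1; have pb := bump_profile e0.
have pg := erdelyi_kober_profile a01 pb.
have G0 := Gamma_onem_gt0 a01; set G := (Gamma (1 - a))^-1 in G0 *.
pose p := (1 + x) / 2; pose q := (3 + x) / 4.
have pq : p <= q by rewrite /p /q; lra.
have xp : x <= p by rewrite /p; lra.
have q1 : q <= 1 by rewrite /q; lra.
pose k := a / 4 * (G * (e * ((1 - x) / 8) ^+ 3)).
apply: (@le_trans _ _ (\int[mu]_(z in `]p, q]) cst k z)).
  rewrite Rintegral_cst_itv// /k /q /p le_eqVlt; apply/orP; left; apply/eqP.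
  by field.
apply: (@le_trans _ _ (\int[mu]_(z in `]p, q])
    ((z - (1 - a / 2) * x) * erdelyi_kober a (bump e) z))); last first.
  apply: ge0_subset_Rintegral => //.
  - exact: integrable_volterra pg _ _ _.
  - move=> z; rewrite /= in_itv/= => /andP[xz z1].
    by have /andP[] := volterra_integrand_bound a01 pg x0 (ltW xz) z1.
  - by apply: subset_itv; rewrite bnd_simp.
apply: le_Rintegral => //.
- exact: integrable_cst_itv.
- exact: integrable_volterra pg _ _ _.
- move=> z; rewrite /= in_itv/= => /andP[pz zq].
  have z0 : 0 <= z by rewrite /p in pz; lra.
  have z1 : z < 1 by rewrite /q in zq; lra.
  have h3 : 0 <= ((1 - x) / 8) ^+ 3 by apply: exprn_ge0; lra.
  rewrite /k ler_pM//.
  + lra.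
  + by apply: mulr_ge0; [exact: ltW|exact: mulr_ge0].
  + rewrite /p in pz; nra.
  + apply: le_trans (erdelyi_kober_bump a01 e0 z0 z1).
    apply: ler_wpM2l; first exact: ltW.
    apply: ler_wpM2l => //; apply: lerXn2r; rewrite ?nnegrE; rewrite /q in zq; lra.
Qed.

(** The bump is at most 1 and m + 1 >= 2, so its power m + 1 is at most its square e^2 (1 - x)^4.
    One factor [e] is absorbed by the constant, the rest is the bound of [volterra_bump]. *)
Lemma bump_subsolution a m e x : 0 < a < 1 -> 1 < m -> 0 <= e -> e <= 1 ->
  e <= (m + 1) * (a * (Gamma (1 - a))^-1 / 8192) ->
  bump e x <= porous_map a m (bump e) x.
Proof.
move=> a01 m1 e0 e1 ec.
have m2 : 2%:R <= m + 1 by lra.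
have mp : 0 <= m + 1 by exact: le_trans m2.
have mn0 : m + 1 != 0 by rewrite gt_eqF// (lt_le_trans _ m2).
have [x1|x1] := leP 1 x.
  rewrite (_ : bump e x = 0) ?powR_ge0//.
  rewrite /bump (_ : Num.max _ (1 - _) = 0) ?expr0n ?mulr0//.
  by apply/max_idPl; rewrite subr_le0 le_max x1 orbT.
set y := Num.max 0 x.
have y0 : 0 <= y by rewrite le_max lexx.
have y1 : y < 1 by rewrite gt_max ltr01 x1.
have z0 : 0 <= 1 - y by rewrite subr_ge0 ltW.
have z1 : 1 - y <= 1 by rewrite gerBl.
have -> : bump e x = e * (1 - y) ^+ 2.
  rewrite /bump -/y (_ : Num.max _ _ = 1 - y)//.
  by apply/max_idPr; rewrite subr_ge0 ltW.
have h0 : 0 <= e * (1 - y) ^+ 2 by rewrite mulr_ge0// sqr_ge0.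
have -> : e * (1 - y) ^+ 2 = ((e * (1 - y) ^+ 2) `^ (m + 1)) `^ (m + 1)^-1.
  by rewrite -powRrM mulfV// powRr1.
have vb := volterra_bump a01 e0 y0 y1.
have pg := erdelyi_kober_profile a01 (bump_profile e0).
apply: ge0_ler_powR; rewrite ?nnegrE ?powR_ge0//.
- by rewrite invr_ge0.
- by apply: mulr_ge0 => //; exact: volterra_ge0 pg _.
apply: le_trans (ler_wpM2l mp vb) => {vb pg}.
move: (a * _ / _) ec => c ec.
have [->|e0'] := eqVneq e 0.
  by rewrite mul0r (powR0 mn0) mulr0 mul0r mulr0.
have b01 : 0 < e * (1 - y) ^+ 2 <= 1.
  apply/andP; split; first by rewrite mulr_gt0 ?exprn_gt0 ?subr_gt0// lt_def e0'.
  apply: mulr_ile1 => //; first exact: sqr_ge0.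
  by rewrite expr_le1.
apply: (le_trans (ger_powR b01 m2)).
rewrite powR_mulrn// exprMn -exprM (_ : (2 * 2)%N = 4%N)// expr2 [leRHS]mulrA.
apply: ler_wpM2r; first exact: exprn_ge0.
rewrite mulrA; exact: ler_wpM2r.
Qed.

End Subsolution.

(** * Existence of a positive fixed point, and tools for its regularity *)

Section Existence.
Context {R : realType}.
Notation mu := (@lebesgue_measure R).
Implicit Types (a m x y z B C : R) (f g h U V W : R -> R).

(** The zero function is a fixed point too; lying above a bump makes this one positive before 1. *)
Lemma porous_fixpoint_exists a m : 0 < a < 1 -> 1 < m ->
  exists C U, [/\ profile C U, forall x, x < 1 -> 0 < U x &
                  forall x, U x = porous_map a m U x].
Proof.
move=> a01 m1; have m2 : 2%:R <= m + 1 by lra.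
have mp : 0 < m + 1 by lra.
(* With this choice C^(m+1) >= C^2 >= (m + 1) * ek_norm a * C. *)
pose C := Num.max 1 ((m + 1) * ek_norm a).
have C1 : 1 <= C by rewrite le_max lexx.
have C0 : 0 <= C by exact: le_trans C1.
have hC : (m + 1) * (ek_norm a * C) <= C `^ (m + 1).
  apply: le_trans (ler_powR C1 m2); rewrite powR_mulrn// expr2 mulrA.
  by rewrite ler_wpM2r// le_max lexx orbT.
have G0 := Gamma_onem_gt0 a01.
have [c [c0 cE]] : exists c, 0 < c /\ c = (m + 1) * (a * (Gamma (1 - a))^-1 / 8192).
  eexists; split; last reflexivity.
  apply: mulr_gt0; first exact: mp.
  apply: divr_gt0; last by rewrite ltr0n.
  by apply: mulr_gt0; [case/andP: a01|exact: G0].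
pose e := Num.min 1 c.
have e0 : 0 < e by rewrite lt_min ltr01.
have e1 : e <= 1 by rewrite ge_min lexx.
have ec : e <= c by rewrite ge_min lexx orbT.
have pb : profile C (bump e).
  have [nb bb] := bump_profile (ltW e0); split=> // x.
  by have /andP[-> /le_trans->] := bb x; rewrite // (le_trans e1).
have sb x : bump e x <= porous_map a m (bump e) x.
  by apply: (bump_subsolution x a01 m1 (ltW e0) e1); rewrite -cE.
have [U [pU bU UT]] := porous_map_fixpoint a01 m1 pb hC sb.
exists C, U; split=> // x x1; apply: lt_le_trans (bU x).
rewrite /bump mulr_gt0// exprn_gt0// lt_max; apply/orP; right.
by rewrite subr_gt0 gt_max ltr01.
Qed.

(** The power is differentiable away from 0. At a zero of [f], as occurs at the front, it suffices
    that f y < e^(1/p). *)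
Lemma continuous_powR_comp f (p : R) x : 0 < p -> (forall y, 0 <= f y) ->
  {for x, continuous f} -> {for x, continuous (fun y => f y `^ p)}.
Proof.
move=> p0 f0 cf; have [fx0|fx0] := eqVneq (f x) 0.
  apply/cvgrPdist_lt => e e0; rewrite fx0 powR0 ?gt_eqF//.
  have ep0 : 0 < e `^ p^-1 by exact: powR_gt0.
  move/cvgrPdist_lt : cf => /(_ _ ep0); apply: filterS => y.
  rewrite fx0 !sub0r !normrN !ger0_norm ?powR_ge0// => fy.
  have -> : e = (e `^ p^-1) `^ p by rewrite -powRrM mulVf ?gt_eqF// powRr1// ltW.
  by apply: gt0_ltr_powR => //; rewrite nnegrE ?powR_ge0.
have fxp : 0 < f x by rewrite lt_def fx0 f0.
apply: (@continuous_comp _ _ _ f (fun t => t `^ p)) => //.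
apply: differentiable_continuous; apply/derivable1_diffP; apply: ex_derive.
exact: is_derive1_powR.
Qed.

(* The base point -1 makes 0 and 1 interior to the domain of the primitive. *)
Definition prim g x : R := \int[mu]_(z in `[-1, x]) g z.

End Existence.

(** * Regularity of the fixed points *)

Section Regularity.
Context {R : realType}.
Notation mu := (@lebesgue_measure R).
Implicit Types (a m x y z B C : R) (f g h U V W : R -> R).

(** A bound on [[-1, 2]] suffices, which admits the integrand z g(z), possibly unbounded on the
    whole line. *)
Lemma primB B h x y : measurable_fun [set: R] h -> (forall z, -1 <= z <= 2 -> `|h z| <= B) ->
  -1 <= x -> x <= y -> y <= 2 ->
  \int[mu]_(z in `]x, y]) h z = prim h y - prim h x.
Proof.
move=> mh hB x1 xy y2; rewrite /prim Rintegral_itvB ?bnd_simp//.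
apply: (@integrable_bounded_itv _ _ _ _ _ _ B) => // t /andP[t1 t2].
by apply: hB; rewrite t1/= (le_trans t2).
Qed.

Lemma prim_continuous B h x : measurable_fun [set: R] h ->
  (forall z, -1 <= z <= 2 -> `|h z| <= B) -> -1 < x < 2 ->
  {for x, continuous (prim h)}.
Proof.
move=> mh hB x12.
apply: (@within_continuous_continuous _ _ _ (-1) 2); [lra| |by rewrite in_itv].
apply: parameterized_integral_continuous; first lra.
exact: (@integrable_bounded_itv _ _ _ _ _ _ B).
Qed.

Lemma prim_derive B h x : measurable_fun [set: R] h ->
  (forall z, -1 <= z <= 2 -> `|h z| <= B) -> -1 < x < 2 ->
  {for x, continuous h} -> is_derive x 1 (prim h) (h x).
Proof.
move=> mh hB /andP[x1 x2] ch.
have ih : mu.-integrable `[-1, 2] (EFin \o h).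
  exact: (@integrable_bounded_itv _ _ _ _ _ _ B).
have [dF Fx] := continuous_FTC1_closed x2 ih x1 ch.
split; first exact: dF.
by rewrite -derive1E.
Qed.

(** Dominated convergence, with [C] times the weight as majorant. *)
Lemma erdelyi_kober_continuous a C V : 0 < a < 1 -> profile C V -> continuous V ->
  continuous (erdelyi_kober a V).
Proof.
move=> a01 pV cV x.
rewrite (_ : erdelyi_kober a V = fun y => (Gamma (1 - a))^-1 *
    \int[mu]_(s in `]0, 1[) (ek_weight a s * V (s `^ (- (a / 2)) * y))); last first.
  by apply/funext => y; exact: erdelyi_koberE pV.
apply: cvgM; first exact: cvg_cst.
have x01 : x \in (`]x - 1, x + 1[%classic : set R).
  by rewrite inE/= in_itv/=; lra.
apply: (@continuity_under_integral _ _ _ mu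
  (fun y s => ek_weight a s * V (s `^ (- (a / 2)) * y)) `]0, 1[%classic _ (x - 1) (x + 1)
  _ _ (fun s => ek_weight a s * C) _ _ x x01) => //.
- by move=> y _; exact: integrable_ek_integrand pV.
- apply: aeW => s _ y _; apply: cvgM; first exact: cvg_cst.
  apply: (@continuous_comp _ _ _ (fun y => s `^ (- (a / 2)) * y) V); last exact: cV.
  by apply: cvgM; [exact: cvg_cst|exact: cvg_id].
- exact: integrable_ek_weightZr.
- move=> y _; apply: aeW => s _.
  have /andP[V0 VC] := pV.2 (s `^ (- (a / 2)) * y).
  by rewrite ger0_norm ?mulr_ge0 ?ek_weight_ge0// ler_wpM2l ?ek_weight_ge0.
Qed.

Lemma erdelyi_kober_ge1 a C V : 0 < a < 1 -> profile C V ->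
  (forall x, 1 <= x -> V x = 0) -> forall x, 1 <= x -> erdelyi_kober a V x = 0.
Proof.
move=> a01 pV V1 x x1; apply/eqP; rewrite eq_le.
have := erdelyi_kober_le_value a01 pV (le_trans ler01 x1).
rewrite V1// mulr0 => ->/=.
by have /andP[] := (erdelyi_kober_profile a01 pV).2 x.
Qed.

(** Splitting the kernel takes [x] out of the integrands, so that regularity in [x] reduces to that
    of two primitives. *)
Lemma volterra_prim a B g x : 0 < a < 1 -> profile B g -> 0 <= x -> x <= 1 ->
  volterra a g x = (prim (fun z => z * g z) 1 - prim (fun z => z * g z) x)
    - (1 - a / 2) * x * (prim g 1 - prim g x).
Proof.
move=> a01 pg x0 x1; have mg := profile_measurable pg.
have mzg : measurable_fun [set: R] (fun z => z * g z) by exact: measurable_funM.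
have gB z : `|g z| <= B by have /andP[g0 gB] := pg.2 z; rewrite ger0_norm.
have zgB z : -1 <= z <= 2 -> `|z * g z| <= 2 * B.
  by move=> z12; rewrite normrM ler_pM// ler_norml; lra.
rewrite -(primB (B := 2 * B))//; [|lra|lra].
rewrite -(primB (B := B))//; [|lra|lra].
rewrite -RintegralZl//; last first.
  exact: (@integrable_bounded_itv _ _ _ _ _ _ B).
rewrite -RintegralB//; first by apply: eq_Rintegral => z _; ring.
  apply: (@integrable_bounded_itv _ _ _ _ _ _ (2 * B)) => // t tx; apply: zgB; lra.
apply: (@integrable_bounded_itv _ _ _ _ _ _ (`|(1 - a / 2) * x| * B)).
  exact: measurable_funM.
by move=> t _; rewrite normrM ler_wpM2l.
Qed.

(** A bootstrap: [U] and I[U] are only known to be monotone and bounded, but primitives of bounded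
    functions are continuous. *)
Lemma fixpoint_continuous a m C U : 0 < a < 1 -> 1 < m -> profile C U ->
  (forall x, U x = porous_map a m U x) -> continuous U.
Proof.
move=> a01 m1 pU UT x; have pg := erdelyi_kober_profile a01 pU.
set g := erdelyi_kober a U in pg; set B := _ * C in pg.
have mg := profile_measurable pg.
have mzg : measurable_fun [set: R] (fun z => z * g z) by exact: measurable_funM.
have gB z : `|g z| <= B by have /andP[g0 gB] := pg.2 z; rewrite ger0_norm.
have zgB z : -1 <= z <= 2 -> `|z * g z| <= 2 * B.
  by move=> z12; rewrite normrM ler_pM// ler_norml; lra.
have M0 (y : R) : 0 <= Num.max 0 y by rewrite le_max lexx.
(* Truncating at 1 changes nothing, since [volterra] vanishes from 1 on, and it makes
   [volterra_prim] applicable at every point. *)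
pose clamp y : R := Num.min 1 (Num.max 0 y).
have c0 y : 0 <= clamp y by rewrite le_min ler01 M0.
have c1 y : clamp y <= 1 by rewrite ge_min lexx.
have cc : continuous clamp.
  move=> y; apply: continuous_min; first exact: cvg_cst.
  by apply: continuous_max; [exact: cvg_cst|exact: cvg_id].
have UE : U = fun y => ((m + 1) * volterra a g (clamp y)) `^ (m + 1)^-1.
  apply/funext => y; rewrite UT /porous_map -/g /clamp.
  have [//|M1] := leP (Num.max 0 y) 1.
  by rewrite !volterra_ge1// ltW.
rewrite UE; apply: (@continuous_powR_comp _ (fun y => (m + 1) * volterra a g (clamp y))).
- by rewrite invr_gt0; lra.
- by move=> y; apply: mulr_ge0; [lra|exact: volterra_ge0 pg _].
- apply: (@continuousM _ _ (fun _ => m + 1) (fun y => volterra a g (clamp y))).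
    exact: cst_continuous.
  rewrite (_ : (fun y => volterra a g (clamp y)) = (fun y =>
    (prim (fun z => z * g z) 1 - prim (fun z => z * g z) (clamp y))
    - (1 - a / 2) * clamp y * (prim g 1 - prim g (clamp y)))); last first.
    by apply/funext => y; exact: volterra_prim pg _ _.
  have cl12 : -1 < clamp x < 2 by have := c0 x; have := c1 x; lra.
  have cH : {for x, continuous (fun y => prim (fun z => z * g z) (clamp y))}.
    apply: (@continuous_comp _ _ _ clamp (prim (fun z => z * g z))); first exact: cc.
    exact: (prim_continuous mzg zgB).
  have cG : {for x, continuous (fun y => prim g (clamp y))}.
    apply: (@continuous_comp _ _ _ clamp (prim g)); first exact: cc.
    exact: (prim_continuous mg (fun z _ => gB z)).
  have cst_c (k : R) : {for x, continuous (fun _ : R => k)} by exact: cst_continuous.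
  apply: (@continuousB _ R^o _
    (fun y => prim (fun z => z * g z) 1 - prim (fun z => z * g z) (clamp y))
    (fun y => (1 - a / 2) * clamp y * (prim g 1 - prim g (clamp y)))).
    by apply: (@continuousB _ R^o _ (fun _ => prim (fun z => z * g z) 1)).
  apply: (@continuousM _ _ (fun y => (1 - a / 2) * clamp y)
    (fun y => prim g 1 - prim g (clamp y))).
    by apply: (@continuousM _ _ (fun _ => 1 - a / 2) clamp) => //; exact: cc.
  by apply: (@continuousB _ R^o _ (fun _ => prim g 1)).
Qed.

(* The derivative of [volterra a g], which is the value of [U ^ m * U'] for a fixed
   point [U] of [porous_map a m] with [g = erdelyi_kober a U]. *)
Definition flux a g x : R := - (a / 2) * x * g x - (1 - a / 2) * (prim g 1 - prim g x).

(** The moving end point contributes - (a / 2) x g(x), the derivative of the kernel contributes the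
    other term of [flux]. *)
Lemma volterra_derive a B g x : 0 < a < 1 -> profile B g -> continuous g -> 0 < x < 1 ->
  is_derive x 1 (fun y => volterra a g (Num.max 0 y)) (flux a g x).
Proof.
move=> a01 pg cg x01; have mg := profile_measurable pg.
have mzg : measurable_fun [set: R] (fun z => z * g z) by exact: measurable_funM.
have gB z : `|g z| <= B by have /andP[g0 gB] := pg.2 z; rewrite ger0_norm.
have zgB z : -1 <= z <= 2 -> `|z * g z| <= 2 * B.
  by move=> z12; rewrite normrM ler_pM// ler_norml; lra.
have x12 : -1 < x < 2 by lra.
have /andP[x0 x1] := x01.
have dG : is_derive x 1 (prim g) (g x).
  by apply: (prim_derive mg (fun z _ => gB z)) => //; exact: cg.
have dH : is_derive x 1 (prim (fun z => z * g z)) (x * g x).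
  apply: (prim_derive mzg zgB) => //; apply: cvgM; [exact: cvg_id|exact: cg].
pose F y := (prim (fun z => z * g z) 1 - prim (fun z => z * g z) y)
    - (1 - a / 2) * y * (prim g 1 - prim g y).
have dF : is_derive x 1 F (flux a g x).
  rewrite /F; apply: is_derive_eq.
  by rewrite /GRing.scale/= /flux; field.
apply: (near_eq_is_derive _ dF); near=> y.
have y0 : 0 <= y by near: y; apply: filterS (lt_nbhsr x0) => ? /ltW.
have y1 : y <= 1 by near: y; apply: filterS (lt_nbhsl x1) => ? /ltW.
by rewrite (max_idPr y0) (volterra_prim a01 pg y0 y1).
Unshelve. all: by end_near. Qed.

End Regularity.

(** * Scaling *)

Section Scaling.
Context {R : realType}.
Notation mu := (@lebesgue_measure R).
Implicit Types (a m x y z B C l : R) (f g h U V W : R -> R).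

(** Where [U] is positive the root is differentiable, and U^m U' is the derivative of U^(m+1) / (m +
    1), which is [volterra]. *)
Lemma fixpoint_derive a m C U x : 0 < a < 1 -> 1 < m -> profile C U ->
  (forall x, U x = porous_map a m U x) -> 0 < x < 1 -> 0 < U x ->
  exists2 d, is_derive x 1 U d & U x `^ m * d = flux a (erdelyi_kober a U) x.
Proof.
move=> a01 m1 pU UT x01 Ux; have pg := erdelyi_kober_profile a01 pU.
have cg := erdelyi_kober_continuous a01 pU (fixpoint_continuous a01 m1 pU UT).
have mp : 0 < m + 1 by lra.
have mn0 : m + 1 != 0 by rewrite gt_eqF.
pose p := (m + 1)^-1.
pose w y := (m + 1) * volterra a (erdelyi_kober a U) (Num.max 0 y).
have UE y : U y = w y `^ p by rewrite UT.
have wx0 : 0 < w x.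
  have w0 : 0 <= w x.
    by apply: mulr_ge0; [exact: ltW|apply: volterra_ge0 pg _ => //; rewrite le_max lexx].
  rewrite lt_def w0 andbT; apply/eqP => wx; move: Ux.
  by rewrite UE wx powR0 ?ltxx// invr_eq0.
have dw : is_derive x 1 w ((m + 1) * flux a (erdelyi_kober a U) x).
  by apply: is_deriveZ; exact: volterra_derive pg cg x01.
exists ((p * w x `^ (p - 1)) * ((m + 1) * flux a (erdelyi_kober a U) x)).
  have eU : (fun t => t `^ p) \o w = U by apply/funext => y; rewrite UE.
  have dp : is_derive (w x) 1 (fun t => t `^ p) (p * w x `^ (p - 1)).
    exact: is_derive1_powR.
  by have := is_derive1_comp dp dw; rewrite eU.
rewrite UE -powRrM.
(* As p (m + 1) = 1, the two exponents add up to 0. *)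
have e : w x `^ (p * m) * w x `^ (p - 1) = 1.
  rewrite -powRD ?(gt_eqF wx0) ?implybT//.
  rewrite (_ : p * m + (p - 1) = 0) ?powRr0// /p; by field.
transitivity ((w x `^ (p * m) * w x `^ (p - 1)) * (p * (m + 1)) *
  flux a (erdelyi_kober a U) x); first by ring.
by rewrite e mulVf// !mul1r.
Qed.

Lemma flux_cvg1 a B g : profile B g -> continuous g -> g 1 = 0 ->
  flux a g x @[x --> (1 : R)] --> (0 : R).
Proof.
move=> pg cg g1; have mg := profile_measurable pg.
have gB z : `|g z| <= B by have /andP[g0 gB] := pg.2 z; rewrite ger0_norm.
have c1 : -1 < (1 : R) < 2 by lra.
have cG : {for 1, continuous (prim g)} := prim_continuous mg (fun z _ => gB z) c1.
have -> : 0 = - (a / 2) * 1 * g 1 - (1 - a / 2) * (prim g 1 - prim g 1) by rewrite g1; ring.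
apply: cvgB.
  by apply: cvgM; [apply: cvgM; [exact: cvg_cst|exact: cvg_id]|exact: cg].
by apply: cvgM; [exact: cvg_cst|apply: cvgB; [exact: cvg_cst|exact: cG]].
Qed.

Lemma Rintegral_scale f l y : 0 < l -> 0 <= y -> continuous f ->
  \int[mu]_(z in `[0, l * y]) f z = l * \int[mu]_(z in `[0, y]) f (l * z).
Proof.
move=> l0 y0 cf.
have dl : derive1 (fun z : R => l * z) = (fun=> l).
  by apply/funext => z; rewrite derive1E derive_val /GRing.scale/= mulr1.
have cl : continuous (fun z : R => l * z).
  by move=> z; apply: cvgM; [exact: cvg_cst|exact: cvg_id].
have cfl : continuous (fun z : R => f (l * z)).
  by move=> z; apply: (@continuous_comp _ _ _ (fun z : R => l * z) f); [exact: cl|exact: cf].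
have icl : mu.-integrable `[0, y] (EFin \o (fun z => f (l * z))).
  apply: continuous_compact_integrable; first exact: segment_compact.
  exact: continuous_subspaceT.
rewrite -RintegralZl// /Rintegral; congr fine.
have := @integration_by_substitution_increasing R (fun z => l * z) f 0 y y0.
rewrite mulr0 => ->.
- by apply: eq_integral => z _; rewrite dl /= mulrC.
- by move=> u v _ _ uv; rewrite ltr_pM2l.
- by rewrite dl => ? _; exact: cst_continuous.
- by rewrite dl; exact: is_cvg_cst.
- by rewrite dl; exact: is_cvg_cst.
- split.
  + by move=> u _; exact: ex_derive.
  + by apply: cvg_at_right_filter; exact: cl.
  + by apply: cvg_at_left_filter; exact: cl.
- exact: continuous_subspaceT.
Qed.

(** This expresses the integral of the theorem through the same two primitives as [volterra_prim],
    so that comparing the two forms of the equation becomes algebra. *)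
Lemma Rintegral_kernel a B g y : profile B g -> 0 <= y -> y <= 1 ->
  \int[mu]_(z in `[0, y]) (((1 - a / 2) * y - z) * g z) =
    (1 - a / 2) * y * (prim g y - prim g 0)
    - (prim (fun z => z * g z) y - prim (fun z => z * g z) 0).
Proof.
move=> pg y0 y1; have mg := profile_measurable pg.
have mzg : measurable_fun [set: R] (fun z => z * g z) by exact: measurable_funM.
have gB z : `|g z| <= B by have /andP[g0 gB] := pg.2 z; rewrite ger0_norm.
have zgB z : -1 <= z <= 2 -> `|z * g z| <= 2 * B.
  by move=> z12; rewrite normrM ler_pM// ler_norml; lra.
have ig : mu.-integrable `]0, y] (EFin \o g).
  exact: (@integrable_bounded_itv _ _ _ _ _ _ B).
have izg : mu.-integrable `]0, y] (EFin \o (fun z => z * g z)).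
  apply: (@integrable_bounded_itv _ _ _ _ _ _ (2 * B)) => // t ty; apply: zgB; lra.
have icg : mu.-integrable `]0, y] (EFin \o (fun z => (1 - a / 2) * y * g z)).
  apply: (@integrable_bounded_itv _ _ _ _ _ _ (`|(1 - a / 2) * y| * B)).
    exact: measurable_funM.
  by move=> t _; rewrite normrM ler_wpM2l.
rewrite -(primB (h := fun z => z * g z) (B := 2 * B))//; last lra.
rewrite -(primB (h := g) (B := B))//; last lra.
rewrite -RintegralZl// -RintegralB//.
rewrite -Rintegral_itv_obnd_cbnd; first by apply: eq_Rintegral => z _; rewrite mulrBl.
apply: (@integrable_bounded_itv _ _ _ _ _ _ ((`|(1 - a / 2) * y| + 1) * B)).
  by apply: measurable_funM => //; exact: measurable_funB.
move=> t ty; rewrite normrM ler_pM//.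
rewrite (le_trans (ler_normB _ _))// lerD2l ler_norml; lra.
Qed.

(** The operator averages the function over multiples of its argument, hence commutes with
    dilations. *)
Lemma erdelyi_kober_scale a C U (c l z : R) : 0 < a < 1 -> 0 <= c -> 0 < l -> profile C U ->
  erdelyi_kober a (fun x => c * U (x / l)) z = c * erdelyi_kober a U (z / l).
Proof.
move=> a01 c0 l0 pU.
have pV : profile (c * C) (fun x => c * U (x / l)).
  have [nU Ub] := pU; split => [x y xy|x].
    by rewrite ler_wpM2l// nU// ler_wpM2r// invr_ge0 ltW.
  by have /andP[U0 UC] := Ub (x / l); rewrite mulr_ge0//= ler_wpM2l.
rewrite (erdelyi_koberE _ _ pV) (erdelyi_koberE _ _ pU) mulrCA; congr (_ * _).
rewrite -RintegralZl//; last exact: integrable_ek_integrand pU.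
by apply: eq_Rintegral => s _; rewrite mulrCA (mulrA _ z).
Qed.

End Scaling.

(** * Normalization of the fixed point and verification of the conditions *)

Theorem theorem2 (R : realType) (alpha m : R)
    (halpha : 0 < alpha < 1) (hm : 1 < m) :
  exists (beta eta_s : R) (U : R -> R),
    [/\ 0 < beta /\ 0 < eta_s,
        M_set U,
        (forall eta : R, 0 <= eta < eta_s -> 0 < U eta) /\
        (forall eta : R, eta_s <= eta -> U eta = 0),
        forall eta : R, 0 <= eta <= eta_s ->
          U eta `^ (m + 1) =
          1 + (m + 1) *
              (- beta * eta +
               \int[@lebesgue_measure R]_(z in `[0, eta])
                 (((1 - alpha / 2) * eta - z) * erdelyi_kober alpha U z))
      & no_flux m U eta_s].
Proof.
have [C [V [pV V0 VT]]] := porous_fixpoint_exists halpha hm.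
have mp : 0 < m + 1 by lra.
have mn0 : m + 1 != 0 by rewrite gt_eqF.
have cV := fixpoint_continuous halpha hm pV VT.
have pg := erdelyi_kober_profile halpha pV.
have cg := erdelyi_kober_continuous halpha pV cV.
have V1 x : 1 <= x -> V x = 0.
  move=> x1; have x0 := le_trans ler01 x1.
  by rewrite VT /porous_map (max_idPr x0) volterra_ge1// mulr0 powR0// invr_eq0.
have g1 : erdelyi_kober alpha V 1 = 0 by apply: (erdelyi_kober_ge1 halpha pV V1).
have kg := @Rintegral_kernel R alpha _ _ _ pg.
have vE x : 0 <= x -> x <= 1 ->
    V x `^ (m + 1) = (m + 1) * volterra alpha (erdelyi_kober alpha V) x.
  move=> x0 x1; rewrite VT /porous_map (max_idPr x0) -powRrM mulVf// powRr1//.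
  by apply: mulr_ge0; [exact: ltW|exact: volterra_ge0 pg _].
have vP x (x0 : 0 <= x) (x1 : x <= 1) := volterra_prim halpha pg x0 x1.
have fd x := @fixpoint_derive R alpha m C V x halpha hm pV VT.
have fl := flux_cvg1 alpha pg cg g1.
have ks c l z := @erdelyi_kober_scale R alpha C V c l z halpha.
set g := erdelyi_kober alpha V in pg cg kg vE vP fd fl ks g1.
set G := prim g in vP kg; set H := prim (fun z => z * g z) in vP kg.
have V00 : 0 < V 0 by exact: V0.
pose c := (V 0)^-1.
have c0 : 0 < c by rewrite invr_gt0.
pose l := c `^ (m / 2).
have l0 : 0 < l by exact: powR_gt0.
have ln0 : l != 0 by rewrite gt_eqF.
pose K := c `^ (m + 1).
have K0 : 0 < K by exact: powR_gt0.
have llc : l * l * c = K.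
  rewrite -powRD ?(gt_eqF c0) ?implybT// -[X in _ * X]powRr1 ?ltW//.
  by rewrite -powRD ?(gt_eqF c0) ?implybT//; congr (_ `^ _); field.
have KV0 : K * V 0 `^ (m + 1) = 1.
  by rewrite -powRM ?ltW// /c mulVf ?gt_eqF// powR1.
(* The rescaled equation at 0: this is the constant term 1 of the theorem. *)
have e0 : K * ((m + 1) * (H 1 - H 0)) = 1.
  by rewrite -[RHS]KV0 vE// vP//; ring.
(* Needed for beta > 0: on []0, 1]] the integral of [g] dominates that of z g(z), which is
   [volterra alpha g 0] and is positive because [V 0] is. *)
have G10 : 0 < G 1 - G 0.
  have mg := profile_measurable pg.
  have [_ gb] := pg.
  have gB z : `|g z| <= ek_norm alpha * C by have /andP[z0 zB] := gb z; rewrite ger0_norm.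
  have : 0 < volterra alpha g 0.
    rewrite -(pmulr_rgt0 _ mp) -vE// powR_gt0//.
  move/lt_le_trans; apply.
  rewrite /G -(primB mg (fun z _ => gB z))//; last lra.
  apply: le_Rintegral => //.
  - exact: integrable_volterra pg _ _ _.
  - exact: (@integrable_bounded_itv _ _ _ _ _ _ (ek_norm alpha * C)).
  - move=> z; rewrite /= in_itv/= => /andP[z0 z1].
    by rewrite mulr0 subr0 ler_piMl//; case/andP: (gb z).
have a2 : 0 < 1 - alpha / 2 by lra.
pose U x := c * V (x / l).
have nV := pV.1.
have Vge0 x : 0 <= V x by have /andP[] := pV.2 x.
have U1 x : l <= x -> U x = 0.
  by move=> lx; rewrite /U V1 ?mulr0// ler_pdivlMr// mul1r.
(* Writing integrals over []y, 1]] as those over []0, 1]] minus those over []0, y]] leaves a term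
   linear in y = x / l; beta is read off from its coefficient. *)
exists (K * (1 - alpha / 2) * (G 1 - G 0) / l), l, U; split.
- by split=> //; rewrite divr_gt0// !mulr_gt0.
- split.
  + split.
      apply: continuous_subspaceT => x; apply: cvgM; first exact: cvg_cst.
      apply: (@continuous_comp _ _ _ (fun x : R => x / l) V); last exact: cV.
      by apply: cvgM; [exact: cvg_id|exact: cvg_cst].
    apply/cvg_ex; exists 0; apply/cvgrPdist_lt => e e1.
    by near=> x; rewrite U1 ?subr0 ?normr0.
  + by rewrite /U mul0r /c mulVf ?gt_eqF.
  + move=> x x0; rewrite /U mulr_ge0 ?(ltW c0)//=.
    rewrite /c ler_pdivrMl// mulr1; apply: nV.
    by rewrite divr_ge0// ltW.
- split=> [x /andP[x0 xl]|x]; last exact: U1.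
  by rewrite /U mulr_gt0// V0// ltr_pdivrMr// mul1r.
- move=> x /andP[x0 xl]; pose y := x / l.
  have y0 : 0 <= y by rewrite divr_ge0// ltW.
  have y1 : y <= 1 by rewrite ler_pdivrMr// mul1r.
  have xE : x = l * y by rewrite /y mulrC divfK.
  rewrite [in LHS]/U -/y powRM ?(ltW c0)// -/K vE// vP//.
  (* One factor [l] comes from dz, one from the homogeneous kernel, and [c] from I[U]; their product
     is [K]. *)
  have -> : \int[@lebesgue_measure R]_(z in `[0, x])
     (((1 - alpha / 2) * x - z) * erdelyi_kober alpha U z) =
     l * (l * c * \int[@lebesgue_measure R]_(z in `[0, y]) (((1 - alpha / 2) * y - z) * g z)).
    pose f z := ((1 - alpha / 2) * x - z) * erdelyi_kober alpha U z.
    have kU z : erdelyi_kober alpha U z = c * g (z / l) by rewrite ks// ltW.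
    transitivity (\int[@lebesgue_measure R]_(z in `[0, l * y]) f z); first by rewrite -xE.
    rewrite Rintegral_scale//; last first.
      move=> z; apply: cvgM; first by apply: cvgB; [exact: cvg_cst|exact: cvg_id].
      rewrite (funext kU); apply: cvgM; first exact: cvg_cst.
      apply: (@continuous_comp _ _ _ (fun x : R => x / l) g); last exact: cg.
      by apply: cvgM; [exact: cvg_id|exact: cvg_cst].
    congr (_ * _); rewrite -RintegralZl//; last first.
      apply: continuous_compact_integrable; first exact: segment_compact.
      apply: continuous_subspaceT => z.
      apply: (@continuousM _ _ (fun z : R => (1 - alpha / 2) * y - z) g); last exact: cg.
      by apply: (@continuousB _ R^o _ (fun=> (1 - alpha / 2) * y) id);
        [exact: cst_continuous|exact: cvg_id].
    apply: eq_Rintegral => z _; rewrite /f kU {1}xE.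
    rewrite (_ : l * z / l = z); last by rewrite mulrC mulKf.
    ring.
  rewrite kg// -[X in _ = X + _]e0 -llc xE; field.
  exact: ln0.
(* By the chain rule U^m U' picks up c^m from the power and c / l from the derivative, that is K / l
   in all. *)
- have dU x : 0 < x -> x < l -> exists2 d, is_derive x 1 U d &
      U x `^ m * d = K / l * flux alpha g (x / l).
    move=> x0 xl; have y01 : 0 < x / l < 1.
      by rewrite divr_gt0//= ltr_pdivrMr// mul1r.
    have [d dV dE] := fd _ y01 (V0 _ (proj2 (andP y01))).
    have dl : is_derive x 1 (fun x => x / l) l^-1.
      by apply: is_derive_eq; rewrite scaler0 add0r /GRing.scale/= mulr1.
    have dVl := @is_derive1_comp _ V (fun x : R => x / l) x d l^-1 dV dl.
    exists (c * (d * l^-1)); first exact: (is_deriveZ c dVl).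
    rewrite /U powRM ?(ltW c0)// -dE -/(U x).
    have -> : K = c `^ m * c.
      by rewrite /K -[X in _ * X]powRr1 ?ltW// -powRD// (gt_eqF c0) implybT.
    ring.
  have nx : \forall x \near l^'-, 0 < x /\ x < l.
    near=> x; split; near: x; [exact: nbhs_left_gt|exact: nbhs_left_lt].
  split.
    near=> x; have [x0 xl] : 0 < x /\ x < l by near: x.
    by have [d dUx _] := dU x x0 xl; apply: ex_derive.
  have : (- (K / l * flux alpha g (x / l))) @[x --> l^'-] --> (0 : R).
    rewrite -[0]oppr0 -(mulr0 (K / l)); apply: cvgN; apply: cvgM; first exact: cvg_cst.
    apply: cvg_at_left_filter.
    apply: (@cvg_comp _ _ _ (fun x : R => x / l) (flux alpha g) _ (nbhs (1 : R)));
      last exact: fl.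
    rewrite -(divff ln0); apply: cvgM; [exact: cvg_id|exact: cvg_cst].
  apply: cvg_trans; apply: near_eq_cvg; near=> x.
  have [x0 xl] : 0 < x /\ x < l by near: x.
  have [d dUx dE] := dU x x0 xl.
  by rewrite -dE derive1E (@derive_val _ _ _ _ _ _ _ dUx).
Unshelve. all: by end_near. Qed.
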